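(* If $A$ is an abelian variety over an algebraically closed field $k$, then for every $r\geq 1$ the groups $F^rCH_0(A)\otimes\mathbb{Z}[\frac{1}{(r-1)!}]$ and $G^rCH_0(A)\otimes\mathbb{Z}[\frac{1}{(r-1)!}]$ coincide (as subgroups of $CH_0(A)\otimes\mathbb{Z}[\frac{1}{(r-1)!}]$).
   Context: $CH_0(A)$ is the group of zero-cycles on $A$ modulo rational equivalence, and $[a]$ is the class of a closed point $a$ (here $a\in A(k)$ since $k$ is algebraically closed). Filtration $G^r$ (for $k$ algebraically closed): $G^0CH_0(A)=CH_0(A)$ and, for $r\ge1$, $G^rCH_0(A)$ is the subgroup generated by all elements $\sum_{j=0}^{r}(-1)^{r-j}\sum_{1\leq\nu_1<\dots<\nu_j\leq r}[a_{\nu_1}+\dots+a_{\nu_j}]$ with $a_1,\dots,a_r\in A(k)$, the summand for $j=0$ being $(-1)^r[0]$. Filtration $F^r$ (definition over a general field $k$): for a field extension $L/E$, $\mathrm{res}_{L/E}:A(E)\to A(L)$ is the natural restriction map; if $L/E$ is finite, $\mathrm{Tr}_{L/E}:A(L)\to A(E)$ is the usual trace (norm) homomorphism. For $r\ge 1$, the Somekawa group $K_r(k;A)=K(k;A,\dots,A)$ ($r$ copies of $A$) is $\big[\bigoplus_{k'/k} A(k')\otimes\cdots\otimes A(k')\big]/R$ ($r$ tensor factors over $\mathbb{Z}$), where the sum runs over all finite extensions $k'$ of $k$ and $R$ is the subgroup generated by: (1) $a_1\otimes\cdots\otimes \mathrm{Tr}_{L/E}(a_i)\otimes\cdots\otimes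 a_r-\mathrm{res}_{L/E}(a_1)\otimes\cdots\otimes a_i\otimes\cdots\otimes \mathrm{res}_{L/E}(a_r)$ for all finite extensions $L\supset E\supset k$, all $i$, $a_i\in A(L)$ and $a_j\in A(E)$ for $j\ne i$; (2) $\sum_{v}\mathrm{ord}_v(f)\,(s_v(x_1)\otimes\cdots\otimes s_v(x_r))$ for all function fields $K/k$ in one variable, $f\in K^\times$, $x_1,\dots,x_r\in A(K)$, where $v$ runs over all places of $K$ over $k$, $k_v$ is the residue field of $v$, and $s_v:A(K)\to A(k_v)$ is the specialization map, i.e. the composite $A(K)\to A(K_v)\simeq A(\mathcal{O}_v)\to A(k_v)$ with $K_v$ the completion of $K$ at $v$ and $\mathcal{O}_v$ its ring of integers. (For $k$ algebraically closed only $k'=k$ occurs and the relations (1) are trivial.) The class of $a_1\otimes\cdots\otimes a_r$, $a_i\in A(k')$, is denoted $\{a_1,\dots,a_r\}_{k'/k}$. $S_r(k;A)$ is the quotient of $K_r(k;A)$ by the subgroup generated by all $\{x_1,\dots,x_r\}_{k'/k}-\{x_{\sigma(1)},\dots,x_{\sigma(r)}\}_{k'/k}$ with $\sigma$ a permutation of $\{1,\dots,r\}$; and $S_0(k;A)=\mathbb{Z}$. For $r\ge 0$ there is a homomorphism $\Phi_r:CH_0(A)\to S_r(k;A)$, $[a]\mapsto\{a,\dots,a\}_{k(a)/k}$ for closed points $a$ with residue field $k(a)$ ($\Phi_0$ being the degree map). Then $F^0CH_0(A)=CH_0(A)$ and $F^rCH_0(A)=\bigcap_{j=0}^{r-1}\ker\Phi_j$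 for $r\ge1$. *)

(* Defs.v *)
From HB Require Import structures.
From mathcomp Require Import all_boot all_order all_algebra perm.
From mathcomp Require Import boolp classical_sets.
From mathcomp.multinomials Require Import freeg mpoly.

Set Implicit Arguments.
Unset Strict Implicit.
Unset Printing Implicit Defensive.

Import GRing.Theory Num.Theory.
Local Open Scope ring_scope.
Local Open Scope quotient_scope.

Section GeneratedSubgroup.
Variables (V : zmodType) (X : V -> Prop).

Definition subgroup_gen : {pred V} :=
  [pred v | `[< forall S : zmodClosed V, (forall x, X x -> x \in S) -> v \in S >]].

Lemma subgroup_gen_zmod_closed : zmod_closed subgroup_gen.
Proof.
split; first by apply/asboolP => S _; exact: rpred0.
move=> x y /asboolP xs /asboolP ys; apply/asboolP => S XS.
by apply: rpredB; [exact: xs | exact: ys].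
Qed.

HB.instance Definition _ :=
  GRing.isZmodClosed.Build V subgroup_gen subgroup_gen_zmod_closed.

Lemma mem_subgroup_gen x : X x -> x \in subgroup_gen.
Proof. by move=> Xx; apply/asboolP => S; exact. Qed.

Definition quotient : zmodType := Quotient.quot (subgroup_gen : zmodClosed V).

Definition cls : V -> quotient := fun v => \pi_quotient v.

Lemma cls_is_zmod_morphism : zmod_morphism cls.
Proof. by move=> x y; rewrite /cls raddfB. Qed.

HB.instance Definition _ :=
  GRing.isZmodMorphism.Build V quotient cls cls_is_zmod_morphism.

Lemma cls_eq x y : (cls x == cls y) = (x - y \in subgroup_gen).
Proof. by rewrite Quotient.idealrBE. Qed.

Lemma cls_gen x : X x -> cls x = 0.
Proof.
move=> Xx; apply/eqP; rewrite -[0](raddf0 cls) cls_eq subr0.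
exact: mem_subgroup_gen.
Qed.

(* A homomorphism on V that kills X, as a map on V / <X>. *)
Definition descend (W : zmodType) (f : V -> W) (c : quotient) : W := f (repr c).

Lemma subgroup_gen_ker (W : zmodType) (f : {additive V -> W}) :
  (forall x, X x -> f x = 0) -> forall v, v \in subgroup_gen -> f v = 0.
Proof.
move=> fX v /asboolP vX.
pose P : {pred V} := fun u => f u == 0.
have Pz : zmod_closed P.
  split=> [|x y]; rewrite !unfold_in ?raddf0 // raddfB.
  by move=> /eqP-> /eqP->; rewrite subr0.
pose PS : zmodClosed V := HB.pack P (GRing.isZmodClosed.Build V P Pz).
by apply/eqP; apply: (vX PS) => x /fX fx; rewrite unfold_in /= /P fx.
Qed.

Lemma descendE (W : zmodType) (f : {additive V -> W}) :
  (forall x, X x -> f x = 0) -> forall v, descend f (cls v) = f v.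
Proof.
move=> fX v; apply/eqP; rewrite -subr_eq0 -raddfB; apply/eqP.
by apply: (subgroup_gen_ker fX); rewrite -cls_eq /cls reprK.
Qed.

Lemma descend_is_zmod_morphism (W : zmodType) (f : {additive V -> W}) :
  (forall x, X x -> f x = 0) -> zmod_morphism (descend f).
Proof.
move=> fX c d; rewrite -[c](reprK) -[d](reprK) -/(cls _) -/(cls (repr d)).
by rewrite -raddfB !descendE // raddfB.
Qed.

End GeneratedSubgroup.

Lemma raddf_sumz (V W : zmodType) (phi : {additive V -> W}) (I : Type) (s : seq I)
    (g : I -> V) (n : I -> int) :
  phi (\sum_(i <- s) g i *~ n i) = \sum_(i <- s) phi (g i) *~ n i.
Proof. by rewrite raddf_sum; apply: eq_bigr => i _; rewrite raddfMz. Qed.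

Section FreeLift.
Variables (T : choiceType) (W : zmodType) (f : T -> W).

Definition free_lift (z : {freeg T}) : W := \sum_(t <- dom z) f t *~ coeff t z.

Lemma free_liftE (s : seq T) z :
  uniq s -> {subset dom z <= s} -> free_lift z = \sum_(t <- s) f t *~ coeff t z.
Proof.
move=> us zs; rewrite [RHS](bigID (mem (dom z))) /= [X in _ + X]big1.
  rewrite addr0 -big_filter; apply: perm_big; apply: uniq_perm.
  - exact: uniq_dom.
  - exact: filter_uniq.
  - by move=> t; rewrite mem_filter; case: (boolP (t \in dom z)) => // /zs ->.
by move=> t tz; rewrite coeff_outdom.
Qed.

Lemma free_lift_is_zmod_morphism : zmod_morphism free_lift.
Proof.
move=> x y; set s := undup (dom x ++ dom y ++ dom (x - y)).
have us : uniq s by exact: undup_uniq.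
rewrite !(@free_liftE s) //; last first.
- by move=> t tz; rewrite mem_undup !mem_cat tz ?orbT.
- by move=> t tz; rewrite mem_undup !mem_cat tz ?orbT.
- by move=> t tz; rewrite mem_undup !mem_cat tz ?orbT.
rewrite -sumrB; apply: eq_bigr => t _.
by rewrite coeffB mulrzBr.
Qed.

HB.instance Definition _ :=
  GRing.isZmodMorphism.Build {freeg T} W free_lift free_lift_is_zmod_morphism.

Lemma free_liftU t : free_lift << t >> = f t.
Proof.
rewrite (@free_liftE [:: t]) //; first by rewrite big_seq1 coeffU eqxx mul1r.
by move=> u; rewrite domU1.
Qed.

End FreeLift.

Section Tensor.
Variables M N : zmodType.

Definition bilinearity (z : {freeg (M * N)%type}) : Prop :=
  (exists x x' y, z = << (x + x', y) >> - << (x, y) >> - << (x', y) >>) \/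
  (exists x y y', z = << (x, y + y') >> - << (x, y) >> - << (x, y') >>).

Definition tensor : zmodType := quotient bilinearity.

Definition tens (x : M) (y : N) : tensor := cls bilinearity << (x, y) >>.

End Tensor.

(* The image of H (x) N -> M (x) N for a subgroup H of M; this map is injective
   when N is flat over Z, as Z[1/n] is. *)
Definition tensor_sub (M N : zmodType) (H : {pred M}) : {pred tensor M N} :=
  subgroup_gen (fun z => exists2 x, x \in H & exists y, z = tens x y).

Arguments tensor_sub {M} N H.

Section TensorPower.
Variables (M : zmodType) (r : nat).

Definition multilinearity (z : {freeg {ffun 'I_r -> M}}) : Prop :=
  exists (a b c : {ffun 'I_r -> M}) (i : 'I_r),
    [/\ a i = b i + c i,
        forall j, j != i -> a j = b j /\ a j = c j &
        z = << a >> - << b >> - << c >>].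

Definition tensor_power : zmodType := quotient multilinearity.

Definition tens_pow (a : {ffun 'I_r -> M}) : tensor_power :=
  cls multilinearity << a >>.

End TensorPower.

(* Z[1/n] for n > 0, as an additive subgroup of the rationals. *)
Definition invert_nat (n : nat) : {pred rat} :=
  [pred q : rat | `[< exists m, q * n%:R ^+ m \is a Num.int >]].

Lemma invert_nat_zmod_closed n : zmod_closed (invert_nat n).
Proof.
split; first by apply/asboolP; exists 0%N; rewrite mul0r rpred0.
move=> x y /asboolP[a xa] /asboolP[b yb]; apply/asboolP; exists (a + b)%N.
rewrite exprD mulrBl mulrA [X in _ - X]mulrCA mulrC [X in _ - X]mulrC.
by rewrite rpredB // rpredM // ?rpredX ?rpred_nat // mulrC.
Qed.

HB.instance Definition _ n :=
  GRing.isZmodClosed.Build rat (invert_nat n) (invert_nat_zmod_closed n).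

Record Zinv (n : nat) := MkZinv { Zinv_val :> rat; _ : Zinv_val \in invert_nat n }.
HB.instance Definition _ n := [isSub for @Zinv_val n].
HB.instance Definition _ n := [Choice of Zinv n by <:].
HB.instance Definition _ n := [SubChoice_isSubZmodule of Zinv n by <:].

Section Varieties.
Variable k : closedFieldType.

(* Proj (k[X_0, .., X_n] / I), with I a homogeneous prime ideal that does not
   contain all the variables. *)
Record proj_variety := ProjVariety {
  pv_n : nat;
  pv_ideal : prime_idealr {mpoly k[pv_n.+1]};
  pv_homog : forall p d, p \in pv_ideal -> pihomog mdeg d p \in pv_ideal;
  pv_relevant : exists j : 'I_pv_n.+1, 'X_j \notin pv_ideal }.

(* Points of P^n(K) are represented by their unique homogeneous coordinate
   vector whose first nonzero entry is 1. *)
Definition normalized (K : fieldType) n (x : 'rV[K]_n.+1) : bool :=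
  [exists j, (x 0 j == 1) && [forall j' : 'I_n.+1, (j' < j)%N ==> (x 0 j' == 0)]].

Definition on_variety (X : proj_variety) (K : fieldType) (i : {rmorphism k -> K})
    (x : 'rV[K]_(pv_n X).+1) : bool :=
  `[< forall p, p \in pv_ideal X -> mmap i (x 0) p = 0 >].

Record point (X : proj_variety) (K : fieldType) (i : {rmorphism k -> K}) := Point {
  coords :> 'rV[K]_(pv_n X).+1;
  _ : normalized coords && on_variety i coords }.

HB.instance Definition _ X K i := [isSub for @coords X K i].
HB.instance Definition _ X K i := [Choice of @point X K i by <:].

Definition bihomog n m (d e : nat) (p : {mpoly k[n + m]}) : Prop :=
  forall mon, mon \in msupp p ->
    (\sum_(j < n) mon (lshift m j) = d)%N /\ (\sum_(j < m) mon (rshift n j) = e)%N.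

Definition eval1 n (K : fieldType) (i : {rmorphism k -> K})
    (t : 'I_n.+1 -> {mpoly k[n.+1]}) (u : 'rV[K]_n.+1) : 'rV[K]_n.+1 :=
  \row_l mmap i (u 0) (t l).

Definition eval2 n (K : fieldType) (i : {rmorphism k -> K})
    (t : 'I_n.+1 -> {mpoly k[n.+1 + n.+1]}) (u v : 'rV[K]_n.+1) : 'rV[K]_n.+1 :=
  \row_l mmap i (row_mx u v 0) (t l).

Definition proportional (K : fieldType) n (x y : 'rV[K]_n) : Prop :=
  exists2 c : K, c != 0 & x = c *: y.

(* Morphisms X -> X and X x X -> X, through their action on points over all
   extension fields: locally they are given by tuples of homogeneous (resp.
   bihomogeneous) polynomials over k without common zero. As X and X x X are
   reduced, a morphism is determined by its values on these points. *)
Definition morphism1 (X : proj_variety)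
    (f : forall (K : fieldType) (i : {rmorphism k -> K}), point X i -> point X i) :=
  forall (K : fieldType) (i : {rmorphism k -> K}) (x : point X i),
  exists (t : 'I_(pv_n X).+1 -> {mpoly k[(pv_n X).+1]}) (d : nat),
  [/\ forall l, t l \is d.-homog, eval1 i t x != 0 &
      forall (L : fieldType) (j : {rmorphism k -> L}) (u : point X j),
        eval1 j t u != 0 -> proportional (f L j u) (eval1 j t u)].

Definition morphism2 (X : proj_variety)
    (f : forall (K : fieldType) (i : {rmorphism k -> K}),
           point X i -> point X i -> point X i) :=
  forall (K : fieldType) (i : {rmorphism k -> K}) (x y : point X i),
  exists (t : 'I_(pv_n X).+1 -> {mpoly k[(pv_n X).+1 + (pv_n X).+1]}) (d e : nat),
  [/\ forall l, bihomog d e (t l), eval2 i t x y != 0 &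
      forall (L : fieldType) (j : {rmorphism k -> L}) (u v : point X j),
        eval2 j t u v != 0 -> proportional (f L j u v) (eval2 j t u v)].

(* A projective (irreducible) group variety. Abelian varieties are projective
   and commutative; smoothness is automatic for a group variety over an
   algebraically closed field. The group axioms are imposed on K-points for
   all extensions K of k, i.e. as identities between morphisms. *)
Record abelian_variety := AbelianVariety {
  av_var :> proj_variety;
  av_zero : forall (K : fieldType) (i : {rmorphism k -> K}), point av_var i;
  av_opp : forall (K : fieldType) (i : {rmorphism k -> K}),
    point av_var i -> point av_var i;
  av_add : forall (K : fieldType) (i : {rmorphism k -> K}),
    point av_var i -> point av_var i -> point av_var i;
  av_zero_rational : exists z : 'rV[k]_(pv_n av_var).+1,
    forall (K : fieldType) (i : {rmorphism k -> K}), av_zero i = map_mx i z :> 'rV_ _;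
  av_opp_morphism : morphism1 av_opp;
  av_add_morphism : morphism2 av_add;
  av_addA : forall (K : fieldType) (i : {rmorphism k -> K}), associative (@av_add K i);
  av_addC : forall (K : fieldType) (i : {rmorphism k -> K}), commutative (@av_add K i);
  av_add0 : forall (K : fieldType) (i : {rmorphism k -> K}),
    left_id (av_zero i) (@av_add K i);
  av_addN : forall (K : fieldType) (i : {rmorphism k -> K}),
    left_inverse (av_zero i) (@av_opp K i) (@av_add K i) }.

Definition rat_points (A : abelian_variety) (K : fieldType) (i : {rmorphism k -> K}) :=
  point A i.

HB.instance Definition _ A K i := Choice.on (@rat_points A K i).
HB.instance Definition _ A K i := GRing.isZmodule.Build (@rat_points A K i)
  (@av_addA A K i) (@av_addC A K i) (@av_add0 A K i) (@av_addN A K i).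

Definition base_points (A : abelian_variety) : zmodType :=
  @rat_points A k (idfun : {rmorphism k -> k}).

(* For some t in K transcendental over k, the field K is spanned over k(t) by
   finitely many elements b_j. *)
Definition function_field (K : fieldType) (i : {rmorphism k -> K}) : Prop :=
  exists2 t : K, ~ algebraicOver i t &
  exists b : seq K, forall y : K,
  exists (q : {poly k}) (c : nat -> {poly k}), q != 0 /\
    (map_poly i q).[t] * y = \sum_(j < size b) (map_poly i (c j)).[t] * b`_j.

(* A place of K over k, as a normalized discrete valuation trivial on k. The
   valuation of 0 is irrelevant, and set to 0. *)
Record place (K : fieldType) (i : {rmorphism k -> K}) := Place {
  ord : K -> int;
  ord_zero : ord 0 = 0;
  ord_const : forall c : k, ord (i c) = 0;
  ord_mul : forall x y, x != 0 -> y != 0 -> ord (x * y) = ord x + ord y;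
  ord_add : forall x y, x != 0 -> y != 0 -> x + y != 0 ->
    Order.min (ord x) (ord y) <= ord (x + y);
  ord_unif : exists x, ord x = 1 }.

HB.instance Definition _ K i := gen_eqMixin (@place K i).
HB.instance Definition _ K i := gen_choiceMixin (@place K i).

Definition in_max_ideal (K : fieldType) (i : {rmorphism k -> K}) (v : place i)
  (x : K) : bool := (x == 0) || (0 < ord v x).

(* a in A(k) is the reduction of x in A(K) at v: a suitable homogeneous
   coordinate vector of x is integral at v and congruent to that of a modulo
   the maximal ideal. *)
Definition reduces_to (A : abelian_variety) (K : fieldType) (i : {rmorphism k -> K})
    (v : place i) (x : rat_points A i) (a : base_points A) : Prop :=
  exists2 l : K, l != 0 &
    forall j, in_max_ideal v (l * coords x 0 j - i (coords a 0 j)).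

(* The specialization map s_v : A(K) -> A(k). The residue field of a place of a
   function field over the algebraically closed field k is k; the reduction
   exists and is unique, so the default value 0 is not used. *)
Definition specialize (A : abelian_variety) (K : fieldType) (i : {rmorphism k -> K})
    (v : place i) (x : rat_points A i) : base_points A :=
  xget 0 (reduces_to v x).

(* s enumerates the (finitely many) zeros and poles of f. *)
Definition div_support (K : fieldType) (i : {rmorphism k -> K}) (f : K)
    (s : seq (place i)) : Prop :=
  uniq s /\ forall v, (v \in s) = (ord v f != 0).

End Varieties.

Section Filtrations.
Variables (k : closedFieldType) (A : abelian_variety k).

(* Zero-cycles phi_* (div f), for all morphisms phi : C -> A from a complete
   regular curve C and all nonzero rational functions f on C. With K = k(C), the
   closed points of C are the places of K over k, and by the valuative criterion
   such a phi is the same as a point x of A(K), with phi(v) = s_v(x). *)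
Definition rationally_trivial (z : {freeg base_points A}) : Prop :=
  exists (K : fieldType) (i : {rmorphism k -> K}) (f : K) (x : rat_points A i)
         (s : seq (place i)),
    [/\ function_field i, f != 0, div_support f s &
        z = \sum_(v <- s) << specialize v x >> *~ ord v f].

Definition CH0 : zmodType := quotient rationally_trivial.

Definition pt_class (a : base_points A) : CH0 := cls rationally_trivial << a >>.

Section Somekawa.
Variable r : nat.

(* As k is algebraically closed, its only finite extension is k itself; hence
   the sum over finite extensions has one term, and the trace relations are
   trivial. *)
Definition weil_relation (z : tensor_power (base_points A) r) : Prop :=
  exists (K : fieldType) (i : {rmorphism k -> K}) (f : K)
         (x : 'I_r -> rat_points A i) (s : seq (place i)),
    [/\ function_field i, f != 0, div_support f s &
        z = \sum_(v <- s) tens_pow [ffun j => specialize v (x j)] *~ ord v f].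

Definition somekawa : zmodType := quotient weil_relation.

Definition symbol (a : {ffun 'I_r -> base_points A}) : somekawa :=
  cls weil_relation (tens_pow a).

Definition symmetry (z : somekawa) : Prop :=
  exists (a : {ffun 'I_r -> base_points A}) (s : {perm 'I_r}),
    z = symbol a - symbol [ffun j => a (s j)].

(* This is S_r(k; A) for r > 0; S_0(k; A) is Z by definition. *)
Definition sym_somekawa : zmodType := quotient symmetry.

Definition sym_symbol (a : {ffun 'I_r -> base_points A}) : sym_somekawa :=
  cls symmetry (symbol a).

Definition Phi_cycle : {freeg base_points A} -> sym_somekawa :=
  free_lift (fun a => sym_symbol [ffun => a]).

HB.instance Definition _ := GRing.Additive.on Phi_cycle.

Lemma Phi_cycle_trivial z : rationally_trivial z -> Phi_cycle z = 0.
Proof.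
move=> [K [i [f [x [s [Ki f0 fs ->]]]]]].
rewrite (raddf_sumz Phi_cycle).
rewrite (eq_bigr _ (fun v _ => congr1 (fun c => c *~ _) (free_liftU _ _))).
rewrite -(raddf_sumz (cls symmetry)) -(raddf_sumz (cls weil_relation)).
transitivity (cls symmetry 0); last exact: raddf0.
congr (cls _ _); apply: cls_gen.
exists K, i, f, (fun=> x), s; split=> //; exact: eq_bigr.
Qed.

(* Phi_r : CH_0(A) -> S_r(k; A), for r > 0. *)
Definition Phi : CH0 -> sym_somekawa := descend Phi_cycle.

HB.instance Definition _ := GRing.isZmodMorphism.Build CH0 sym_somekawa Phi
  (descend_is_zmod_morphism Phi_cycle_trivial).

Lemma Phi_pt_class a : Phi (pt_class a) = sym_symbol [ffun => a].
Proof. by rewrite /Phi (descendE Phi_cycle_trivial) /= /Phi_cycle free_liftU. Qed.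

End Somekawa.

(* Phi_0 is the map CH_0(A) -> Z induced by the degree of cycles (principal
   divisors on complete curves have degree 0); hence its kernel is the set of
   classes of cycles of degree 0. *)
Definition in_ker_Phi (j : nat) (c : CH0) : Prop :=
  if j is 0 then exists2 z, deg z = 0 & c = cls rationally_trivial z
  else Phi j c = 0.

Definition F_filtration (r : nat) : {pred CH0} :=
  [pred c | `[< forall j, (j < r)%N -> in_ker_Phi j c >]].

Definition G_generator (r : nat) (a : 'I_r -> base_points A) : CH0 :=
  \sum_(j < r.+1)
    (\sum_(S : {set 'I_r} | #|S| == j) pt_class (\sum_(nu in S) a nu)) *~ (-1) ^+ (r - j).

Definition G_filtration (r : nat) : {pred CH0} :=
  if r is 0 then predT else subgroup_gen (fun c => exists a, c = @G_generator r a).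

End Filtrations.

Arguments F_filtration {k} A r.
Arguments G_filtration {k} A r.

(* Main.v *)
(* The generators of G^r are the r-th differences D(a_1, .., a_r) at 0 of the
   point class a |-> [a]. Polarization of the multilinear symbol gives
   Phi_j D(a_1, .., a_r) = 0 for j < r, so that G^r <= F^r, and
   Phi_r D(a_1, .., a_r) = r! {a_1, .., a_r}. Conversely
   {a_1, .., a_r} |-> D(a_1, .., a_r) induces a map Psi_r : S_r -> CH_0 / G^(r+1):
   it is additive in each a_i because
   D(a + b, ..) = D(a, b, ..) + D(a, ..) + D(b, ..), and it respects the Weil
   relations because specialization at a place is additive. As Psi_r Phi_r = r!
   on G^r / G^(r+1), induction on r shows that 1! 2! .. (r-1)! F^r <= G^r. *)
Require Import Defs.
From HB Require Import structures.
From mathcomp Require Import all_boot all_order all_algebra perm.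
From mathcomp Require Import boolp.
From mathcomp.multinomials Require Import freeg mpoly.
From mathcomp Require Import zify ring.

Set Implicit Arguments.
Unset Strict Implicit.
Unset Printing Implicit Defensive.

Import Order.TTheory GRing.Theory Num.Theory.
Local Open Scope ring_scope.

(** * Valuations and congruence modulo the maximal ideal of a place *)

Section Places.
Variables (k : closedFieldType) (K : fieldType) (i : {rmorphism k -> K}).
Variable v : place i.
Implicit Types (x y : K) (a b c : k).

Lemma ord1 : ord v 1 = 0.
Proof. by rewrite -(rmorph1 i) ord_const. Qed.

Lemma ordN x : ord v (- x) = ord v x.
Proof.
have [->|x0] := eqVneq x 0; first by rewrite oppr0.
by rewrite -mulN1r ord_mul ?oppr_eq0 ?oner_eq0 // -(rmorphN1 i) ord_const add0r.
Qed.

Lemma ordV x : ord v x^-1 = - ord v x.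
Proof.
have [->|x0] := eqVneq x 0; first by rewrite invr0 ord_zero.
by apply/eqP; rewrite -addr_eq0 -ord_mul ?invr_eq0 // mulVf // ord1.
Qed.

Lemma in_max_ideal0 : in_max_ideal v 0.
Proof. by rewrite /in_max_ideal eqxx. Qed.

Lemma in_max_idealD x y :
  in_max_ideal v x -> in_max_ideal v y -> in_max_ideal v (x + y).
Proof.
rewrite /in_max_ideal => /predU1P[->|xm]; first by rewrite add0r.
move=> /predU1P[->|ym]; first by rewrite addr0 xm orbT.
have [->|x0] := eqVneq x 0; first by rewrite add0r ym orbT.
have [->|y0] := eqVneq y 0; first by rewrite addr0 xm orbT.
have [//|xy0] /= := eqVneq (x + y) 0.
by apply: lt_le_trans (ord_add v x0 y0 xy0); rewrite lt_min xm.
Qed.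

Lemma in_max_idealN x : in_max_ideal v (- x) = in_max_ideal v x.
Proof. by rewrite /in_max_ideal oppr_eq0 ordN. Qed.

Lemma in_max_idealM x y :
  0 <= ord v y -> in_max_ideal v x -> in_max_ideal v (x * y).
Proof.
rewrite /in_max_ideal => yO /predU1P[->|xm]; first by rewrite mul0r eqxx.
have [->|x0] := eqVneq x 0; first by rewrite mul0r eqxx.
have [->|y0] := eqVneq y 0; first by rewrite mulr0 eqxx.
by rewrite ord_mul // ltr_wpDr // orbT.
Qed.

Lemma in_max_ideal_const a : in_max_ideal v (i a) = (a == 0).
Proof. by rewrite /in_max_ideal ord_const ltxx orbF fmorph_eq0. Qed.

(* [x] is integral at [v], with residue [a]. *)
Definition congr_const x a := in_max_ideal v (x - i a).

Lemma congr_const_refl a : congr_const (i a) a.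
Proof. by rewrite /congr_const subrr in_max_ideal0. Qed.

Lemma congr_const_integral x a : congr_const x a -> 0 <= ord v x.
Proof.
rewrite /congr_const => xa; rewrite -[x](subrK (i a)).
move: xa => /predU1P[->|xa]; first by rewrite add0r ord_const.
have [a0|a0] := eqVneq a 0.
  by move: xa; rewrite a0 rmorph0 subr0 addr0; exact: ltW.
have [->|xa0] := eqVneq (x - i a) 0; first by rewrite add0r ord_const.
have [->|x0] := eqVneq (x - i a + i a) 0; first by rewrite ord_zero.
apply: le_trans (ord_add v xa0 _ x0); last by rewrite fmorph_eq0.
by rewrite ord_const le_min lexx ltW.
Qed.

Lemma congr_constD x y a b :
  congr_const x a -> congr_const y b -> congr_const (x + y) (a + b).
Proof.
move=> xa yb; rewrite /congr_const rmorphD opprD addrACA.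
exact: in_max_idealD.
Qed.

Lemma congr_constM x y a b :
  congr_const x a -> congr_const y b -> congr_const (x * y) (a * b).
Proof.
move=> xa yb; rewrite /congr_const rmorphM.
have -> : x * y - i a * i b = (x - i a) * y + (y - i b) * i a by ring.
apply: in_max_idealD; apply: in_max_idealM => //; last by rewrite ord_const.
exact: congr_const_integral yb.
Qed.

Lemma congr_constX x a n : congr_const x a -> congr_const (x ^+ n) (a ^+ n).
Proof.
move=> xa; elim: n => [|n IH]; last by rewrite !exprS; exact: congr_constM.
by rewrite !expr0 -(rmorph1 i) congr_const_refl.
Qed.

Lemma congr_const_uniq x a b : congr_const x a -> congr_const x b -> a = b.
Proof.
rewrite /congr_const => xa xb; apply/eqP; rewrite -subr_eq0 -in_max_ideal_const.
have -> : i (a - b) = (x - i b) + (- (x - i a)) by rewrite rmorphB; ring.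
by apply: in_max_idealD; rewrite ?in_max_idealN.
Qed.

Lemma congr_const_neq0 x a : congr_const x a -> a != 0 -> x != 0.
Proof.
move=> xa; apply: contra_neq => x0; apply: congr_const_uniq xa _.
by rewrite x0 /congr_const rmorph0 subr0 in_max_ideal0.
Qed.

Lemma congr_const_unit x a : congr_const x a -> a != 0 -> ord v x = 0.
Proof.
move=> xa a0; apply/eqP; rewrite eq_le (congr_const_integral xa) andbT leNgt.
apply: contra_neqN a0 => x0; apply: congr_const_uniq xa _.
by rewrite /congr_const rmorph0 subr0 /in_max_ideal x0 orbT.
Qed.

(** Congruences respect sums and products, so reduction commutes with evaluating a polynomial whose
    coefficients lie in [k]. *)
Lemma congr_mmap n (X : 'I_n -> K) (x : 'I_n -> k) (p : {mpoly k[n]}) :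
  (forall j, congr_const (X j) (x j)) ->
  congr_const (mmap i X p) (mmap (idfun : {rmorphism k -> k}) x p).
Proof.
move=> Xx; rewrite /mmap.
apply: (big_ind2 congr_const) => [||m _]; first by rewrite -(rmorph0 i) congr_const_refl.
  by move=> x1 x2 y1 y2; exact: congr_constD.
apply: congr_constM; first exact: congr_const_refl.
apply: (big_ind2 congr_const) => [||j _]; first by rewrite -(rmorph1 i) congr_const_refl.
  by move=> x1 x2 y1 y2; exact: congr_constM.
exact: congr_constX.
Qed.

End Places.

(** * Algebraic dependence of two elements of a function field *)

Lemma linear_dependence (F : fieldType) (S T : finType) (C : S -> T -> F) :
  (#|T| < #|S|)%N ->
  exists2 c : S -> F, (exists a, c a != 0) & forall t, \sum_a c a * C a t = 0.
Proof.
move=> ltTS; pose M := \matrix_(a < #|S|, t < #|T|) C (enum_val a) (enum_val t).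
have /rowV0Pn[u /sub_kermxP uM u0] : kermx M != 0.
  rewrite kermx_eq0 -row_leq_rank -ltnNge.
  exact: leq_ltn_trans (rank_leq_col M) ltTS.
exists (fun a => u 0 (enum_rank a)).
  have /existsP[j uj] : [exists j, u 0 j != 0].
    apply: contraNT u0; rewrite negb_exists => /forallP u0.
    by apply/eqP/rowP => j; rewrite mxE; apply/eqP/negPn/u0.
  by exists (enum_val j); rewrite enum_valK.
move=> t; have /rowP/(_ (enum_rank t)) := uM; rewrite !mxE => uMt; rewrite -[RHS]uMt {uMt}.
rewrite (reindex_onto enum_val enum_rank) => [|a _]; last by rewrite enum_rankK.
by apply: eq_big => a; [rewrite enum_valK eqxx|rewrite !mxE enum_valK enum_rankK].
Qed.

Section FunctionField.
Variables (k : closedFieldType) (K : fieldType) (i : {rmorphism k -> K}).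

Section BoundedSpan.
Variables (t : K) (b : seq K).

(** This is the [k]-span of the elements [t ^+ l * b_j] with [l < D], so its dimension over [k] is
    at most [size b * D]. *)
Definition bounded_span (D : nat) (y : K) : Prop :=
  exists2 c : nat -> {poly k}, forall j, (size (c j) <= D)%N &
    y = \sum_(j < size b) (map_poly i (c j)).[t] * b`_j.

Lemma bounded_span_le D D' y :
  (D <= D')%N -> bounded_span D y -> bounded_span D' y.
Proof. by move=> DD' [c cD ->]; exists c => // j; apply: leq_trans DD'. Qed.

Lemma bounded_span_sum D n (y : 'I_n -> K) :
  (forall l, bounded_span D (y l)) -> bounded_span D (\sum_l y l).
Proof.
move=> yD; elim/big_rec: _ => [|l x _ [c cD ->]].
  exists (fun=> 0) => [j|]; first by rewrite size_poly0.
  by rewrite big1 // => j _; rewrite rmorph0 horner0 mul0r.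
have [d dD ->] := yD l; exists (fun j => d j + c j) => [j|].
  by apply: leq_trans (size_polyD _ _) _; rewrite geq_max dD cD.
by rewrite -big_split; apply: eq_bigr => j _; rewrite rmorphD hornerD mulrDl.
Qed.

Lemma bounded_spanM (p : {poly k}) D y :
  bounded_span D y -> bounded_span (D + size p) ((map_poly i p).[t] * y).
Proof.
move=> [c cD ->]; exists (fun j => p * c j) => [j|].
  apply: leq_trans (size_polyMleq _ _) _; apply: leq_trans (leq_pred _) _.
  by rewrite addnC leq_add2r cD.
rewrite mulr_sumr; apply: eq_bigr => j _.
by rewrite rmorphM hornerM mulrA.
Qed.

(** When [E] clears the denominators of all the [x * b_l], multiplying by [E * x] adds at most [D]
    to the degree bound. Iterating makes the bound grow only linearly in the exponent. *)
Lemma bounded_span_step E D D' x y :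
  (forall l : 'I_(size b), bounded_span D (E * (x * b`_l))) ->
  bounded_span D' y -> bounded_span (D + D') (E * x * y).
Proof.
move=> xD [c cD ->]; rewrite mulr_sumr; apply: bounded_span_sum => l.
rewrite mulrCA -mulrA; apply: (@bounded_span_le (D + size (c l))).
  by rewrite leq_add2l.
exact: bounded_spanM.
Qed.

Lemma bounded_span_iter E D D' x y n :
  (forall l : 'I_(size b), bounded_span D (E * (x * b`_l))) ->
  bounded_span D' y -> bounded_span (n * D + D') ((E * x) ^+ n * y).
Proof.
move=> xD yD; elim: n => [|n IH]; first by rewrite mul1r.
by rewrite exprS -mulrA mulSn -addnA; apply: bounded_span_step.
Qed.

Lemma bounded_span_coef D y : bounded_span D y ->
  exists C : 'I_(size b) * 'I_D -> k, y = \sum_m i (C m) * (t ^+ m.2 * b`_m.1).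
Proof.
move=> [c cD ->]; exists (fun m : 'I__ * 'I__ => (c m.1)`_m.2).
rewrite -(pair_bigA _ (fun (j : 'I_(size b)) (l : 'I_D) =>
  i (c j)`_l * (t ^+ l * b`_j))) /=.
apply: eq_bigr => j _; rewrite (horner_coef_wide (n := D)); last first.
  by apply: leq_trans (cD j); exact: size_poly.
rewrite mulr_suml; apply: eq_bigr => l _.
by rewrite coef_map mulrA.
Qed.

Hypothesis t_transc : ~ algebraicOver i t.
Hypothesis b_span : forall y : K,
  exists (q : {poly k}) (c : nat -> {poly k}), q != 0 /\
    (map_poly i q).[t] * y = \sum_(j < size b) (map_poly i (c j)).[t] * b`_j.

Lemma transc_horner_neq0 (q : {poly k}) : q != 0 -> (map_poly i q).[t] != 0.
Proof. by move=> q0; apply/eqP => qt; apply: t_transc; exists q => //; apply/eqP. Qed.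

Lemma common_denominator (s : seq K) : exists (q : {poly k}) (D : nat),
  q != 0 /\ forall y, y \in s -> bounded_span D ((map_poly i q).[t] * y).
Proof.
elim: s => [|x s [q [D [q0 sD]]]]; first by exists 1, 0%N; rewrite oner_neq0.
have [p [c [p0 px]]] := b_span x; pose d := (\max_(j < size b) size (c j))%N.
have xd : bounded_span d ((map_poly i p).[t] * x).
  exists (fun j => if (j < size b)%N then c j else 0) => [j|].
    case: ifP => jb; last by rewrite size_poly0.
    exact: (leq_bigmax (Ordinal jb)).
  by rewrite px; apply: eq_bigr => j _; rewrite ltn_ord.
exists (p * q), (d + size q + (D + size p))%N; split; first by rewrite mulf_neq0.
move=> y; rewrite inE rmorphM hornerM => /predU1P[->|ys].
  rewrite (mulrC (_.[t])) -mulrA; apply: bounded_span_le (bounded_spanM q xd).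
  exact: leq_addr.
rewrite -mulrA; apply: bounded_span_le (bounded_spanM p (sD _ ys)).
exact: leq_addl.
Qed.

(** Dimension count: after multiplication by a power of a common denominator [E], the [N ^ 2]
    monomials in [x] and [y] lie in a [k]-space whose dimension is bounded linearly in [N], so they
    are dependent for large [N]. *)
Lemma algebraic_dependence_span (x y : K) :
  exists (N : nat) (c : 'I_N * 'I_N -> k), (exists m, c m != 0) /\
    \sum_m i (c m) * (x ^+ m.1 * y ^+ m.2) = 0.
Proof.
(* The products with [x] and [y] allow multiplication by [E * x] and [E * y]. The entries of [b]
   allow multiplication by [E] alone, and [1] starts the iteration. *)
have [q [D [q0 sD]]] := common_denominator
  (1 :: b ++ [seq x * z | z <- b] ++ [seq y * z | z <- b]).
set E := (map_poly i q).[t] in sD.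
have E0 : E != 0 by exact: transc_horner_neq0.
have E1D : bounded_span D (E * 1) by apply: sD; rewrite inE eqxx.
have ED (l : 'I_(size b)) : bounded_span D (E * (1 * b`_l)).
  by apply: sD; rewrite inE !mem_cat mul1r mem_nth ?orbT.
have xD (l : 'I_(size b)) : bounded_span D (E * (x * b`_l)).
  by apply: sD; rewrite inE !mem_cat (map_f (fun z => x * z)) ?orbT // mem_nth.
have yD (l : 'I_(size b)) : bounded_span D (E * (y * b`_l)).
  by apply: sD; rewrite inE !mem_cat (map_f (fun z => y * z)) ?orbT // mem_nth.
(* With [B = size b * D] and [N = 2B + 1], the target has dimension at most [(2N + 1)B = 4B^2 + 3B],
   which is less than [N^2 = 4B^2 + 4B + 1]. *)
pose N := (2 * (size b * D)).+1; pose D' := ((2 * N).+1 * D)%N.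
have mD (m : 'I_N * 'I_N) :
    bounded_span D' (E ^+ (2 * N).+1 * (x ^+ m.1 * y ^+ m.2)).
  (* Padding with [r] factors [E] gives all monomials the same multiplier; the extra factor [E] in
     [(2 * N).+1] comes from the starting element [E * 1]. *)
  pose r := (2 * N - m.1 - m.2)%N.
  have rE : (m.1 + (m.2 + r) = 2 * N)%N.
    by rewrite /r; have := ltn_ord m.1; have := ltn_ord m.2; lia.
  have -> : D' = (m.1 * D + (m.2 * D + (r * D + D)))%N.
    by rewrite /D' -rE; lia.
  have -> : E ^+ (2 * N).+1 * (x ^+ m.1 * y ^+ m.2) =
            (E * x) ^+ m.1 * ((E * y) ^+ m.2 * ((E * 1) ^+ r * (E * 1))).
    by rewrite -rE !mulr1 exprS !exprD !exprMn; ring.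
  by do 3!apply: bounded_span_iter => //.
have /choice[C CE] m := bounded_span_coef (mD m).
have [|c c0 cC] := @linear_dependence _ _ _ C.
  rewrite !card_prod !card_ord /D' /N; nia.
exists N, c; split=> //; apply/eqP.
rewrite -(mulrI_eq0 _ (mulfI (expf_neq0 (2 * N).+1 E0))) mulr_sumr.
under eq_bigr => m _ do rewrite mulrCA CE mulr_sumr.
rewrite exchange_big big1 //= => l _.
under eq_bigr => m _ do rewrite (mulrA (i (c m))) -(rmorphM i).
by rewrite -mulr_suml -(rmorph_sum i) cC rmorph0 mul0r.
Qed.

End BoundedSpan.

Lemma algebraic_dependence (x y : K) : function_field i ->
  exists (N : nat) (c : 'I_N * 'I_N -> k), (exists m, c m != 0) /\
    \sum_m i (c m) * (x ^+ m.1 * y ^+ m.2) = 0.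
Proof. by move=> [t tt [b bt]]; exact: algebraic_dependence_span tt bt x y. Qed.

End FunctionField.

(** * The residue field of a place of a function field is [k] *)

Section Residue.
Variables (k : closedFieldType) (K : fieldType) (i : {rmorphism k -> K}).
Variable v : place i.
Implicit Types (x y u : K).

Lemma ord_ge0D x y : 0 <= ord v x -> 0 <= ord v y -> 0 <= ord v (x + y).
Proof.
move=> xO yO; have [->|x0] := eqVneq x 0; first by rewrite add0r.
have [->|y0] := eqVneq y 0; first by rewrite addr0.
have [->|xy0] := eqVneq (x + y) 0; first by rewrite ord_zero.
by apply: le_trans (ord_add v x0 y0 xy0); rewrite le_min xO.
Qed.

Lemma ord_ge0M x y : 0 <= ord v x -> 0 <= ord v y -> 0 <= ord v (x * y).
Proof.
move=> xO yO; have [->|x0] := eqVneq x 0; first by rewrite mul0r ord_zero.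
have [->|y0] := eqVneq y 0; first by rewrite mulr0 ord_zero.
by rewrite ord_mul // addr_ge0.
Qed.

Lemma ord_horner_ge0 (Q : {poly K}) x :
  (forall j, 0 <= ord v Q`_j) -> 0 <= ord v x -> 0 <= ord v Q.[x].
Proof.
move=> QO xO; rewrite horner_coef; elim/big_ind: _ => [||j _].
- by rewrite ord_zero.
- exact: ord_ge0D.
apply: ord_ge0M => //; elim: (j : nat) => [|n IH]; first by rewrite ord1.
by rewrite exprS ord_ge0M.
Qed.

(** Factors [x] are removed until the constant term is nonzero; it is then a unit, while the other
    terms lie in the maximal ideal. Since [ord v 0 = 0] by convention, the hypothesis on [Q] allows
    zero coefficients. *)
Lemma horner_unit_coef_neq0 (Q : {poly K}) x :
  (forall j, ord v Q`_j = 0) -> x != 0 -> in_max_ideal v x ->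
  Q != 0 -> Q.[x] != 0.
Proof.
move=> Q0 xN0 xm; elim/poly_ind: Q Q0 => [|Q c IH] Q0; first by rewrite eqxx.
have x0 : 0 <= ord v x.
  by case/predU1P: xm => [->|/ltW//]; rewrite ord_zero.
have QS j : ord v Q`_j = 0.
  by have := Q0 j.+1; rewrite coefD coefMX coefC /= addr0.
have c0 : ord v c = 0 by have := Q0 0%N; rewrite coefD coefMX coefC /= add0r.
rewrite hornerMXaddC; have [->|cN0] := eqVneq c 0; last first.
  move=> _; apply/eqP => /(canRL (addKr _)); rewrite addr0 => cE.
  suff : in_max_ideal v c by rewrite /in_max_ideal (negPf cN0) c0 ltxx.
  rewrite cE in_max_idealN mulrC in_max_idealM //.
  by apply: ord_horner_ge0 => // j; rewrite QS.
rewrite !addr0 mulf_eq0 negb_or => /andP[QN0 _].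
by rewrite mulf_neq0 // IH.
Qed.

(* If the residue of [u] avoids [k], then [v] is trivial on [k[u]], which is
   incompatible with an algebraic relation between [u] and a uniformizer. *)
Lemma residue_const u : function_field i -> 0 <= ord v u ->
  exists c, congr_const v u c.
Proof.
move=> Kff uO; have [//|Hu] := pselect (exists c, congr_const v u c).
have u_unit c : u - i c != 0 /\ ord v (u - i c) = 0.
  have /norP[uc0 uc] : ~~ in_max_ideal v (u - i c) by apply/negP => uc; apply: Hu; exists c.
  split=> //; apply/eqP; rewrite eq_le leNgt uc ord_ge0D //.
  by rewrite ordN ord_const.
(* As [k] is algebraically closed, [P] splits into linear factors, whose values at [u] are units by
   [u_unit]. *)
have P_unit (P : {poly k}) : P != 0 ->
    (map_poly i P).[u] != 0 /\ ord v (map_poly i P).[u] = 0.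
  have [s ->] := closed_field_poly_normal P.
  rewrite scaler_eq0 lead_coef_eq0 negb_or => /andP[P0 _].
  rewrite linearZ hornerZ rmorph_prod horner_prod.
  have [s0 s1] : \prod_(z <- s) (map_poly i ('X - z%:P)).[u] != 0 /\
      ord v (\prod_(z <- s) (map_poly i ('X - z%:P)).[u]) = 0.
    elim: s => [|z s [s0 s1]]; first by rewrite big_nil oner_eq0 ord1.
    have [z0 z1] := u_unit z.
    by rewrite big_cons rmorphB /= map_polyX map_polyC !hornerE mulf_neq0 // ord_mul // z1 s1.
  have lc0 : i (lead_coef P) != 0 by rewrite fmorph_eq0 lead_coef_eq0.
  by rewrite mulf_neq0 // ord_mul // s1 ord_const.
have [p p1] := ord_unif v.
have p0 : p != 0 by apply/eqP => p0; move: p1; rewrite p0 ord_zero.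
have [N [c [[m cm] pu]]] := algebraic_dependence p u Kff.
(* The relation is ordered by powers of the uniformizer [p]: its coefficient at [p ^+ a] is the
   value at [u] of [P a], hence zero or a unit. *)
pose P a := \poly_(b < N) (if insub a is Some a' then
  if insub b is Some b' then c (a', b') else 0 else 0).
have PE (a b : 'I_N) : (P a)`_b = c (a, b) by rewrite coef_poly ltn_ord !valK.
pose Q := \poly_(a < N) (map_poly i (P a)).[u].
have : Q.[p] != 0.
  apply: horner_unit_coef_neq0 => // [j||].
  - rewrite coef_poly; case: ifP => _; last by rewrite ord_zero.
    have [->|/P_unit[]//] := eqVneq (P j) 0.
    by rewrite rmorph0 horner0 ord_zero.
  - by rewrite /in_max_ideal p1 orbT.
  (* If [Q] were zero, every [P a] would vanish at [u] and so be zero by [P_unit], against the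
     nontriviality of the relation. *)
  apply: contraNneq cm => Q0; move: m Q0 => [a b] Q0; rewrite -PE.
  suff -> : P a = 0 by rewrite coef0.
  apply/eqP; apply: contraTT isT => /P_unit[Pa _].
  have /(congr1 (fun q : {poly K} => q`_a)) := Q0.
  by rewrite coef_poly ltn_ord coef0 => Pa0; rewrite Pa0 eqxx in Pa.
suff -> : Q.[p] = 0 by rewrite eqxx.
rewrite -[RHS]pu [RHS](eq_bigr (fun m : 'I_N * 'I_N =>
  i (c (m.1, m.2)) * (p ^+ m.1 * u ^+ m.2))); last by case.
rewrite horner_poly -(pair_bigA _ (fun (a b : 'I_N) => i (c (a, b)) * (p ^+ a * u ^+ b))) /=.
apply: eq_bigr => a _; rewrite (@horner_coef_wide _ N); last first.
  by apply: leq_trans (size_poly _ _) _; exact: size_poly.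
rewrite mulr_suml; apply: eq_bigr => b _.
by rewrite coef_map /= PE -mulrA (mulrC (u ^+ b)).
Qed.

End Residue.

(** * Normalized and homogeneous coordinates *)

Lemma normalized_eq (F : fieldType) n (x y : 'rV[F]_n.+1) :
  normalized x -> normalized y -> proportional x y -> x = y.
Proof.
move=> /existsP[p /andP[/eqP xp /forallP xlt]] /existsP[q /andP[/eqP yq /forallP ylt]].
move=> [c c0 xy].
(* The position of the first nonzero coordinate is unchanged by scaling; both vectors have entry 1
   there, so the scalar is 1. *)
suff pq : p = q.
  by move: xp; rewrite xy mxE pq yq mulr1 => ->; rewrite scale1r.
apply: val_inj; case: (ltngtP p q) => // lt.
  have := ylt p; rewrite lt /= => /eqP yp.
  by move/eqP: xp; rewrite xy mxE yp mulr0 eq_sym oner_eq0.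
have := xlt q; rewrite lt xy mxE yq mulr1 /= => /eqP c0'.
by rewrite c0' eqxx in c0.
Qed.

Lemma normalized_neq0 (F : fieldType) n (x : 'rV[F]_n.+1) : normalized x -> x != 0.
Proof.
move=> /existsP[j /andP[/eqP xj _]]; apply/eqP => x0.
by move/eqP: xj; rewrite x0 mxE eq_sym oner_eq0.
Qed.

Lemma normalization (F : fieldType) n (x : 'rV[F]_n.+1) : x != 0 ->
  exists2 c : F, c != 0 & normalized (c *: x).
Proof.
move=> x0; have ex_j : exists j, (fun j => x 0 j != 0) j.
  apply/existsP; apply: contraNT x0; rewrite negb_exists => /forallP x0.
  by apply/eqP/rowP => j; rewrite mxE; apply/eqP/negPn/x0.
have [j0 xj0] := ex_j.
have [p xp p_min] := @arg_minnP _ j0 (fun j => x 0 j != 0) (@nat_of_ord _) xj0.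
exists (x 0 p)^-1; first by rewrite invr_eq0.
apply/existsP; exists p; rewrite mxE mulVf // eqxx /=.
apply/forallP => j; apply/implyP => jp; rewrite mxE mulf_eq0; apply/orP; right.
by apply: contraTT jp => xj; rewrite -leqNgt; exact: p_min.
Qed.

Section Homogeneous.
Variables (k : closedFieldType) (K : fieldType) (i : {rmorphism k -> K}).

Lemma mmap_homog n (X Y : 'I_n -> K) (l : K) d (p : {mpoly k[n]}) :
  (forall j, Y j = l * X j) -> p \is d.-homog ->
  mmap i Y p = l ^+ d * mmap i X p.
Proof.
move=> YX /dhomogP p_d; rewrite /mmap mulr_sumr !big_seq.
apply: eq_bigr => m /p_d <-; rewrite mulrCA; congr (_ * _).
rewrite /mmap1 /= mdegE expr_sum -big_split; apply: eq_bigr => j _.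
by rewrite YX exprMn.
Qed.

Lemma eval2Z n (t : 'I_n.+1 -> {mpoly k[n.+1 + n.+1]}) d e (l l' : K) x y :
  (forall j, bihomog d e (t j)) ->
  eval2 i t (l *: x) (l' *: y) = (l ^+ d * l' ^+ e) *: eval2 i t x y.
Proof.
move=> t_de; apply/rowP => j; rewrite !mxE /mmap mulr_sumr !big_seq.
apply: eq_bigr => m /(t_de j)[<- <-]; rewrite mulrCA; congr (_ * _).
rewrite /mmap1 !big_split_ord !expr_sum mulrACA.
by congr (_ * _); rewrite -big_split; apply: eq_bigr => h _;
  rewrite ?row_mxEl ?row_mxEr mxE exprMn.
Qed.

(** The ideal contains the homogeneous components of its elements, so it suffices to test
    homogeneous equations. *)
Lemma on_variety_homog (X : proj_variety k) (x : 'rV[K]_(pv_n X).+1) :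
  (forall p d, p \in pv_ideal X -> p \is d.-homog -> mmap i (x 0) p = 0) ->
  on_variety i x.
Proof.
move=> x_homog; apply/asboolP => p pX.
rewrite (pihomog_partitionE (leqnn (mmeasure mdeg p))) raddf_sum big1 // => d _.
by apply: (x_homog _ d); [exact: pv_homog | exact: pihomogP].
Qed.

Lemma on_varietyZ (X : proj_variety k) (x : 'rV[K]_(pv_n X).+1) c :
  on_variety i x -> on_variety i (c *: x).
Proof.
move=> /asboolP xX; apply: on_variety_homog => p d pX p_d.
by rewrite (mmap_homog (X := x 0) (l := c) _ p_d) ?xX ?mulr0 // => j; rewrite mxE.
Qed.

End Homogeneous.

(** * Specialization at a place: existence, uniqueness and additivity *)

Section Specialization.
Variables (k : closedFieldType) (A : abelian_variety k).
Variables (K : fieldType) (i : {rmorphism k -> K}) (v : place i).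

Lemma point_normalized (x : rat_points A i) : normalized (coords x).
Proof. by have /andP[] := valP x. Qed.

Hypothesis Kff : function_field i.

(** Dividing by a nonzero coordinate of least valuation makes all coordinates integral and one of
    them 1. Their residues form a nonzero vector that satisfies the homogeneous equations of [A],
    and it remains to normalize it. *)
Lemma reduces_to_exists (x : rat_points A i) : exists a, reduces_to v x a.
Proof.
have ex_j : exists j, (fun j => coords x 0 j != 0) j.
  apply/existsP; apply: contraNT (normalized_neq0 (point_normalized x)).
  rewrite negb_exists => /forallP x0.
  by apply/eqP/rowP => j; rewrite [RHS]mxE; apply/eqP/negPn/x0.
have [j0 xj0] := ex_j.
have [p xp p_min] := @arg_minP _ _ _ j0 (fun j => coords x 0 j != 0)
  (fun j => ord v (coords x 0 j)) xj0.
pose l := (coords x 0 p)^-1.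
have l0 : l != 0 by rewrite invr_eq0.
have lx j : 0 <= ord v (l * coords x 0 j).
  have [->|xj] := eqVneq (coords x 0 j) 0; first by rewrite mulr0 ord_zero.
  by rewrite ord_mul // ordV addrC subr_ge0 p_min.
have /choice[a xa] j := residue_const Kff (lx j).
have ap : a p = 1.
  apply: (congr_const_uniq (xa p)).
  by rewrite mulVf // -(rmorph1 i); exact: congr_const_refl.
have /normalization[c c0 ca] : \row_j a j != 0.
  by apply/eqP => /rowP/(_ p)/eqP; rewrite !mxE ap oner_eq0.
have aX : on_variety (X := A) (idfun : {rmorphism k -> k}) (\row_j a j).
  apply: on_variety_homog => q d qX q_d; apply/esym.
  apply: (@congr_const_uniq _ _ _ v 0).
    by rewrite -(rmorph0 i); exact: congr_const_refl.
  have /andP[_ /asboolP xX] := valP x.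
  rewrite -(mulr0 (l ^+ d)) -(xX _ qX) -(mmap_homog (Y := fun j => l * coords x 0 j) _ _ q_d) //.
  by apply: congr_mmap => j; rewrite mxE.
have /andP caX : normalized (c *: \row_j a j) /\
   on_variety (X := A) (idfun : {rmorphism k -> k}) (c *: \row_j a j).
  by split=> //; exact: on_varietyZ.
exists (Point caX : base_points A); exists (i c * l).
  by rewrite mulf_neq0 ?fmorph_eq0.
move=> j; rewrite -mulrA /= !mxE -/(congr_const _ _ _); apply: congr_constM => //.
exact: congr_const_refl.
Qed.

(** At a coordinate where [x] is a unit, integrality of [y] shows that the scalar [c] is integral.
    Its residue is then the factor from [a] to [b], nonzero because [b] is. *)
Lemma reduces_to_proportional (x y : 'rV[K]_(pv_n A).+1) (a b : 'rV[k]_(pv_n A).+1) :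
  proportional y x -> a != 0 -> b != 0 ->
  (forall j, congr_const v (x 0 j) (a 0 j)) ->
  (forall j, congr_const v (y 0 j) (b 0 j)) -> proportional b a.
Proof.
move=> [c c0 yx] a0 b0 xa yb.
have unit_coord (z : 'rV[K]_(pv_n A).+1) (d : 'rV[k]_(pv_n A).+1) : d != 0 ->
    (forall j, congr_const v (z 0 j) (d 0 j)) ->
    exists2 j, z 0 j != 0 & ord v (z 0 j) = 0.
  move=> d0 zd.
  have /existsP[j dj] : [exists j, d 0 j != 0].
    apply: contraNT d0; rewrite negb_exists => /forallP d0.
    by apply/eqP/rowP => j; rewrite mxE; apply/eqP/negPn/d0.
  exists j; first exact: congr_const_neq0 (zd j) dj.
  exact: congr_const_unit (zd j) dj.
have cO : 0 <= ord v c.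
  have [j xj0 xj] := unit_coord _ _ a0 xa.
  have := congr_const_integral (yb j).
  by rewrite yx mxE ord_mul // xj addr0.
have [c' cc'] := residue_const Kff cO.
have ba : b = c' *: a.
  apply/rowP => j; rewrite mxE; apply: (congr_const_uniq (yb j)).
  by rewrite yx mxE; exact: congr_constM.
exists c' => //; apply: contraNneq b0 => c'0.
by rewrite ba c'0 scale0r.
Qed.

Lemma reduces_to_uniq (x : rat_points A i) (a b : base_points A) :
  reduces_to v x a -> reduces_to v x b -> a = b.
Proof.
move=> [l l0 xa] [l' l'0 xb].
have a_norm := normalized_neq0 (proj1 (andP (valP a))).
have b_norm := normalized_neq0 (proj1 (andP (valP b))).
apply: val_inj; apply: normalized_eq.
- by have /andP[] := valP a.
- by have /andP[] := valP b.
apply: (@reduces_to_proportional (l' *: coords x) (l *: coords x)) => //.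
- exists (l / l'); first by rewrite mulf_neq0 ?invr_eq0.
  by rewrite scalerA divfK.
- by move=> j; rewrite mxE; exact: xb.
- by move=> j; rewrite mxE; exact: xa.
Qed.

Lemma reduces_to_specialize (x : rat_points A i) : reduces_to v x (specialize v x).
Proof. exact: (classical_sets.xgetPex (0 : base_points A) (reduces_to_exists x)). Qed.

Lemma eval2_congr t (x y : 'rV[K]_(pv_n A).+1) (a b : 'rV[k]_(pv_n A).+1) :
  (forall j, congr_const v (x 0 j) (a 0 j)) ->
  (forall j, congr_const v (y 0 j) (b 0 j)) ->
  forall j, congr_const v (eval2 i t x y 0 j)
    (eval2 (idfun : {rmorphism k -> k}) t a b 0 j).
Proof.
move=> xa yb j; rewrite !mxE; apply: congr_mmap => h.
by rewrite -(splitK h); case: (fintype.split h) => h' /=; rewrite ?row_mxEl ?row_mxEr.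
Qed.

(** Near the pair of reductions, addition is given by bihomogeneous polynomials over [k], and
    evaluating these commutes with reduction. *)
Lemma specializeD (x y : rat_points A i) :
  specialize v (x + y) = specialize v x + specialize v y.
Proof.
have [l l0 xa] := reduces_to_specialize x; have [l' l'0 yb] := reduces_to_specialize y.
move: (specialize v x) (specialize v y) xa yb => a b xa yb.
apply: (reduces_to_uniq (reduces_to_specialize _)).
have [t [d [e [t_de t0 t_add]]]] := av_add_morphism a b.
have [c c0 abE] := t_add _ _ a b t0.
have xya : forall j, congr_const v
    (eval2 i t (l *: coords x) (l' *: coords y) 0 j)
    (eval2 (idfun : {rmorphism k -> k}) t (coords a) (coords b) 0 j).
  by apply: eval2_congr => j; rewrite mxE; [exact: xa | exact: yb].
have := xya; rewrite (eval2Z _ _ _ _ _ t_de); set w := _ * _ => xya'.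
have w0 : w != 0 by rewrite mulf_neq0 ?expf_neq0.
(* The same polynomials [t] compute [x + y]: if they all vanished at [x] and [y], so would their
   reductions at [a] and [b]. *)
have txy0 : eval2 i t (coords x) (coords y) != 0.
  apply: contraNneq t0 => txy0; apply/eqP/rowP => j.
  rewrite [RHS]mxE; apply: (congr_const_uniq (xya' j)).
  by rewrite txy0 scaler0 mxE -(rmorph0 i); exact: congr_const_refl.
have [c' c'0 xyE] := t_add _ _ x y txy0.
(* Dividing by [c'] turns the coordinates of [x + y] into the values of [t], [w] accounts for the
   rescaling of [x] and [y], and [c] passes to the normalized coordinates of [a + b]. *)
exists (i c * w / c'); first by rewrite 2?mulf_neq0 ?invr_eq0 ?fmorph_eq0.
move=> j; rewrite -/(congr_const _ _ _).
have -> : coords (a + b) 0 j = c * eval2 (idfun : {rmorphism k -> k}) t (coords a) (coords b) 0 j.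
  by rewrite [coords (a + b)]abE mxE.
have -> : i c * w / c' * coords (x + y) 0 j =
    i c * (w *: eval2 i t (coords x) (coords y)) 0 j.
  by rewrite [coords (x + y)]xyE !mxE mulrA divfK // mulrA.
by apply: congr_constM => //; exact: congr_const_refl.
Qed.

End Specialization.

(** * Iterated finite differences *)

Section Differences.
Variables (M V : zmodType).
Implicit Types (g : M -> V) (s : seq M).

(** The iterated forward difference of [g] at [x], with the entries of [s] as increments. *)
Fixpoint diff s g (x : M) : V :=
  if s is a :: s' then diff s' g (x + a) - diff s' g x else g x.

Lemma diff_cat s1 s2 g x : diff (s1 ++ s2) g x = diff s1 (diff s2 g) x.
Proof. by elim: s1 x => //= a s1 IH x; rewrite !IH. Qed.

Lemma diff_cons a s g x : diff s (diff [:: a] g) x = diff s g (x + a) - diff s g x.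
Proof.
elim: s x => //= b s IH x; rewrite !IH (addrAC x b a) !opprB.
by rewrite addrACA [RHS]addrACA [- diff _ _ (x + a) - _]addrC.
Qed.

Lemma diffC s1 s2 g x : diff s1 (diff s2 g) x = diff s2 (diff s1 g) x.
Proof.
by elim: s1 x => //= a s1 IH x; rewrite !IH -diff_cons.
Qed.

(** Difference operators commute, and exchanging blocks of a list generates all its permutations. *)
Lemma perm_diff s1 s2 g x : perm_eq s1 s2 -> diff s1 g x = diff s2 g x.
Proof.
apply: (catCA_perm_subst (F := fun s => diff s g x)) => t1 t2 t3.
by rewrite !catA !diff_cat diffC.
Qed.

Lemma diffD a b s g x :
  diff (a + b :: s) g x =
  diff [:: a, b & s] g x + diff (a :: s) g x + diff (b :: s) g x.
Proof.
by rewrite /= (addrA x) [RHS]addrAC subrK addrA subrK.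
Qed.

(** By induction on [s]: the subsets containing the head come from the difference shifted by its
    increment, the others from the subtracted term. The exponent [size s + #|S|] has the parity of
    [size s - #|S|] and avoids truncated subtraction. *)
Lemma diff_sets (T : finType) (a : T -> M) (s : seq T) g x : uniq s ->
  diff [seq a t | t <- s] g x =
  \sum_(S : {set T} | S \subset s) g (x + \sum_(t in S) a t) *~ (-1) ^+ (size s + #|S|).
Proof.
elim: s x => [|i s IH] x.
  rewrite (big_pred1 set0) /=; last first.
    by move=> S; rewrite /= -subset0; apply: eq_subset_r => t; rewrite !inE.
  by rewrite big_set0 addr0 cards0.
move=> /andP[is_ us]; rewrite /= !IH //.
rewrite [RHS](bigID (fun S : {set T} => i \in S)) /= -sumrN; congr (_ + _).
  rewrite [RHS](reindex_onto (fun S => i |: S)%SET (fun S => S :\ i)%SET) /=; last first.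
    by move=> S /andP[_ iS]; rewrite setD1K.
  apply: eq_big => [S|S Ss].
    rewrite setU11 andbT; apply/idP/andP => [Ss|[Ss /eqP SE]].
      have iS : i \notin S by apply: contra is_ => /(subsetP Ss).
      split; last by rewrite setU1K.
      by apply/subsetP => t; rewrite !inE => /predU1P[->|/(subsetP Ss)->];
        rewrite ?eqxx ?orbT.
    apply/subsetP => t tS; have := subsetP Ss t; rewrite !inE tS orbT => /(_ isT).
    by case/predU1P => // ti; move: tS; rewrite -SE ti !inE eqxx.
  have iS : i \notin S by apply: contra is_ => /(subsetP Ss).
  rewrite big_setU1 // addrA cardsU1 iS /= addnCA !addSn add0n exprS exprS.
  by rewrite !mulrA mulrNN mulr1 mul1r.
apply: eq_big => [S|S _].
  apply/idP/andP => [Ss|[Ss iS]].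
    split; last by apply: contra is_ => /(subsetP Ss).
    by apply/subsetP => t /(subsetP Ss); rewrite inE => ->; rewrite orbT.
  apply/subsetP => t tS; have := subsetP Ss t tS.
  by rewrite inE => /predU1P[ti|//]; rewrite ti in tS; rewrite tS in iS.
by rewrite addSn exprS mulN1r mulrNz.
Qed.

End Differences.

(* Expand [\prod_t (1 - [t \notin B])] over the subsets of [T]. *)
Lemma sum_sign_supersets (T : finType) (B : {set T}) :
  \sum_(S : {set T} | B \subset S) (-1) ^+ (#|T| + #|S|) = (B == [set: T])%:R :> int.
Proof.
transitivity (\prod_t (1 + - (t \notin B)%:R) : int).
  rewrite bigA_distr big_mkcond; apply: eq_bigr => S _.
  have [BS|/subsetPn[t tB tS]] := ifPn.
    rewrite (bigID (fun t => t \in S)) /= big1 => [|t ->//]; rewrite mul1r.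
    rewrite (eq_bigr (fun=> -1)) => [|t tS]; last first.
      by rewrite (negPf tS) (contra (subsetP BS t) tS).
    rewrite prodr_const [in RHS](eq_card (B := (~: S)%SET)) => [|t]; last first.
      by rewrite !inE.
    by rewrite -(cardsC S) -signr_odd !oddD addbAC addbb signr_odd.
  by rewrite (bigD1 t) //= (negPf tS) tB oppr0 mul0r.
have [->|BT] := eqVneq B [set: T].
  by rewrite big1 // => t _; rewrite inE subr0.
have /subsetPn[t _ tB] : ~~ ([set: T] \subset B) by rewrite subTset.
by rewrite (bigD1 t) //= tB subrr mul0r.
Qed.

Lemma sum_sign_sets (T : finType) : (0 < #|T|)%N ->
  \sum_(S : {set T}) (-1) ^+ (#|T| + #|S|) = 0 :> int.
Proof.
move=> /card_gt0P[t _]; have := sum_sign_supersets (@set0 T).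
rewrite (eq_bigl predT) => [->|S]; last by rewrite sub0set.
by have [/setP/(_ t)|//] := eqVneq set0 [set: T]; rewrite !inE.
Qed.

(** * Polarization of multilinear maps *)

Section Multilinear.
Variables (M W : zmodType) (I T : finType) (m : {ffun I -> M} -> W).
Hypothesis mD : forall (a b c : {ffun I -> M}) i, a i = b i + c i ->
  (forall j, j != i -> a j = b j /\ a j = c j) -> m a = m b + m c.

Definition upd (U : Type) (c : {ffun I -> U}) i (x : U) : {ffun I -> U} :=
  [ffun l => if l == i then x else c l].

Lemma multilinear_updD c i x y : m (upd c i (x + y)) = m (upd c i x) + m (upd c i y).
Proof.
apply: (mD (i := i)) => [|j /negPf ji]; first by rewrite !ffunE eqxx.
by rewrite !ffunE ji.
Qed.

Lemma multilinear_upd_sum c i (P : pred T) (a : T -> M) :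
  m (upd c i (\sum_(t | P t) a t)) = \sum_(t | P t) m (upd c i (a t)).
Proof.
apply: (big_morph (fun x => m (upd c i x))); first exact: multilinear_updD.
by apply: (addrI (m (upd c i 0))); rewrite -multilinear_updD !addr0.
Qed.

(** Expanding the slots in [s] one at a time allows induction. Requiring [phi] to be [t0] outside
    [s] makes each choice on [s] count exactly once. *)
Lemma multilinear_expand_seq (t0 : T) (P : pred T) (a : T -> M) (s : seq I)
    (c : {ffun I -> M}) : uniq s ->
  m [ffun l => if l \in s then \sum_(t | P t) a t else c l] =
  \sum_(phi : {ffun I -> T} | [forall l, if l \in s then P (phi l) else phi l == t0])
    m [ffun l => if l \in s then a (phi l) else c l].
Proof.
elim: s c => [|i s IH] c.
  rewrite (big_pred1 [ffun=> t0]) => [|phi].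
    by move=> _; congr m; apply/ffunP => l; rewrite !ffunE.
  apply/forallP/eqP => [phi0|-> l]; last by rewrite ffunE eqxx.
  by apply/ffunP => l; rewrite ffunE (eqP (phi0 l)).
move=> /andP[is_ us].
have -> : [ffun l => if l \in i :: s then \sum_(t | P t) a t else c l] =
    upd [ffun l => if l \in s then \sum_(t | P t) a t else c l] i (\sum_(t | P t) a t).
  by apply/ffunP => l; rewrite !ffunE inE; case: eqP.
rewrite multilinear_upd_sum.
rewrite [RHS](partition_big (fun phi : {ffun I -> T} => phi i) P) /=; last first.
  by move=> phi /forallP/(_ i); rewrite mem_head.
apply: eq_bigr => t Pt.
have -> : upd [ffun l => if l \in s then \sum_(t | P t) a t else c l] i (a t) =
    [ffun l => if l \in s then \sum_(t | P t) a t else upd c i (a t) l].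
  apply/ffunP => l; rewrite !ffunE; case: eqP => // ->.
  by rewrite (negPf is_).
rewrite IH //.
(* Resetting the value at [i] from [t] to [t0] matches the choices on [i :: s] that take the value
   [t] at [i] with the choices on [s]. *)
rewrite [RHS](reindex_onto (fun phi : {ffun I -> T} => upd phi i t)
  (fun phi => upd phi i t0)) /=; last first.
  move=> phi /andP[_ /eqP <-]; apply/ffunP => l; rewrite !ffunE.
  by case: eqP => // ->.
apply: eq_big => [phi|phi /forallP phiP].
  apply/forallP/andP => [phiP|[/andP[/forallP phiP _] /eqP phiE] l].
    split.
      rewrite [upd phi i t i]ffunE !eqxx andbT; apply/forallP => l; rewrite inE ffunE.
      by case: eqP => //= _; exact: phiP.
    apply/eqP/ffunP => l; rewrite !ffunE; case: eqP => // ->.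
    by have := phiP i; rewrite (negPf is_) => /eqP.
  have [->|li] := eqVneq l i.
    by rewrite (negPf is_) -phiE ffunE eqxx.
  by have := phiP l; rewrite inE ffunE (negPf li).
congr m; apply/ffunP => l; rewrite !ffunE inE.
by case: eqP => // ->; rewrite (negPf is_).
Qed.

Lemma multilinear_expand (t0 : T) (P : pred T) (a : T -> M) :
  m [ffun=> \sum_(t | P t) a t] =
  \sum_(phi : {ffun I -> T} | [forall l, P (phi l)]) m [ffun l => a (phi l)].
Proof.
have := multilinear_expand_seq t0 P a [ffun=> 0] (enum_uniq I).
rewrite (_ : [ffun l => _] = [ffun=> \sum_(t | P t) a t]) => [->|]; last first.
  by apply/ffunP => l; rewrite !ffunE mem_enum.
apply: eq_big => [phi|phi _]; first by apply: eq_forallb => l; rewrite mem_enum.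
by congr m; apply/ffunP => l; rewrite !ffunE mem_enum.
Qed.

(** After expansion and exchange of sums, the term of [phi] carries the signed count of the sets
    containing its image, which vanishes unless [phi] is surjective. *)
Lemma multilinear_polarization (t0 : T) (a : T -> M) :
  \sum_(S : {set T}) m [ffun=> \sum_(t in S) a t] *~ (-1) ^+ (#|T| + #|S|) =
  \sum_(phi : {ffun I -> T} | (phi @: I)%SET == [set: T]) m [ffun l => a (phi l)].
Proof.
under eq_bigr => S _ do rewrite (multilinear_expand t0) mulrz_suml.
rewrite (exchange_big_dep predT) //= [RHS]big_mkcond; apply: eq_bigr => phi _.
have -> : \sum_(S : {set T} | [forall l, phi l \in S])
    m [ffun l => a (phi l)] *~ (-1) ^+ (#|T| + #|S|) =
    m [ffun l => a (phi l)] *~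
      (\sum_(S : {set T} | (phi @: I)%SET \subset S) (-1) ^+ (#|T| + #|S|)).
  rewrite mulrz_sumr; apply: eq_bigl => S.
  apply/forallP/subsetP => [phiS _ /imsetP[l _ ->]//|phiS l].
  by apply: phiS; exact: imset_f.
by rewrite sum_sign_supersets; case: ifP => _; rewrite ?mulr0z ?mulr1z.
Qed.

Lemma multilinear_polarization_lt (t0 : T) (a : T -> M) : (#|I| < #|T|)%N ->
  \sum_(S : {set T}) m [ffun=> \sum_(t in S) a t] *~ (-1) ^+ (#|T| + #|S|) = 0.
Proof.
move=> ltIT; rewrite (multilinear_polarization t0) big1 // => phi /eqP phiT.
by have := leq_imset_card phi I; rewrite phiT cardsT leqNgt ltIT.
Qed.

End Multilinear.

(** A surjection of [I] onto itself is a permutation, and by symmetry all [#|I|!] of them contribute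
    [m a]. *)
Lemma multilinear_polarization_eq (M W : zmodType) (I : finType) (m : {ffun I -> M} -> W)
    (i0 : I) (a : {ffun I -> M}) :
  (forall (a b c : {ffun I -> M}) i, a i = b i + c i ->
    (forall j, j != i -> a j = b j /\ a j = c j) -> m a = m b + m c) ->
  (forall (s : {perm I}), m [ffun i => a (s i)] = m a) ->
  \sum_(S : {set I}) m [ffun=> \sum_(t in S) a t] *~ (-1) ^+ (#|I| + #|S|) = m a *+ #|I|`!.
Proof.
move=> mD mS; rewrite (multilinear_polarization mD i0).
have surjE (phi : {ffun I -> I}) : ((phi @: I)%SET == [set: I]) = injectiveb phi.
  rewrite eqEcard subsetT cardsT; apply/idP/injectiveP => [le_phi|phi_inj].
    have /imset_injP phi_inj : #|(phi @: I)%SET| == #|I|.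
      by rewrite eqn_leq leq_imset_card.
    by move=> x y; exact: phi_inj.
  by rewrite (card_imset _ phi_inj) leqnn.
rewrite (eq_bigl _ _ surjE) (eq_bigr (fun=> m a)).
  by rewrite sumr_const -cardsE card_inj_ffuns ffactnn.
move=> phi /injectiveP phi_inj; rewrite -(mS (perm phi_inj)).
by congr m; apply/ffunP => l; rewrite !ffunE permE.
Qed.

(** * Generated subgroups, free groups and tensor powers *)

Lemma cls_sub_eq (V : zmodType) (X : V -> Prop) x y : X (x - y) -> cls X x = cls X y.
Proof. by move=> Xxy; apply/eqP; rewrite cls_eq mem_subgroup_gen. Qed.

Lemma subgroup_gen_ind (V : zmodType) (X : V -> Prop) (P : V -> Prop) :
  P 0 -> (forall x y, P x -> P y -> P (x - y)) -> (forall x, X x -> P x) ->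
  forall v, v \in subgroup_gen X -> P v.
Proof.
move=> P0 PB PX v /asboolP vX; pose Q : {pred V} := fun u => `[< P u >].
have Qz : zmod_closed Q.
  by split=> [|x y /asboolP Px /asboolP Py]; apply/asboolP => //; exact: PB.
pose QS : zmodClosed V := HB.pack Q (GRing.isZmodClosed.Build V Q Qz).
by apply/asboolP; apply: (vX QS) => x /PX Px; apply/asboolP.
Qed.

Lemma free_decomp (T : choiceType) (z : {freeg T}) :
  z = \sum_(t <- dom z) << t >> *~ coeff t z.
Proof.
rewrite -{1}[z]freeg_sumE; apply: eq_bigr => t _; apply/eqP/freeg_eqP => u.
by rewrite (raddfMz (coeff u)) /= !coeffU mul1r -mulrzr intz mulrC.
Qed.

Lemma deg_sum (T : choiceType) (I : Type) (s : seq I) (t : I -> T) (n : I -> int) :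
  deg (\sum_(i <- s) << t i >> *~ n i) = \sum_(i <- s) n i.
Proof.
rewrite (raddf_sumz (@deg T)); apply: eq_bigr => i _.
by rewrite /= degU intz.
Qed.

Lemma tens_pow_multilinear (M : zmodType) r (a b c : {ffun 'I_r -> M}) i :
  a i = b i + c i -> (forall j, j != i -> a j = b j /\ a j = c j) ->
  tens_pow a = tens_pow b + tens_pow c.
Proof.
move=> ai aj; rewrite /tens_pow -raddfD; apply: cls_sub_eq.
by exists a, b, c, i; split=> //; rewrite opprD addrA.
Qed.

Lemma free_lift_multilinear (M W : zmodType) r (g : {ffun 'I_r -> M} -> W) :
  (forall (a b c : {ffun 'I_r -> M}) i, a i = b i + c i ->
    (forall j, j != i -> a j = b j /\ a j = c j) -> g a = g b + g c) ->
  forall z, multilinearity z -> free_lift g z = 0.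
Proof.
move=> gD z [a [b [c [i [ai aj ->]]]]].
by rewrite !raddfB /= !free_liftU (gD _ _ _ _ ai aj) addrAC addrK subrr.
Qed.

(** * Comparison of the filtrations on zero-cycles *)

Section Filtrations.
Variables (k : closedFieldType) (A : abelian_variety k).
Local Notation M := (base_points A).

Lemma G_generator_sets r (a : 'I_r -> M) :
  G_generator a =
  \sum_(S : {set 'I_r}) pt_class (\sum_(t in S) a t) *~ (-1) ^+ (r + #|S|).
Proof.
rewrite /G_generator.
rewrite [RHS](partition_big (fun S : {set 'I_r} => inord #|S| : 'I_r.+1) predT) //.
apply: eq_bigr => j _; rewrite mulrz_suml; apply: eq_big => [S|S /eqP Sj].
  rewrite /= -val_eqE /= inordK // ltnS.
  by apply: leq_trans (max_card _) _; rewrite card_ord.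
rewrite -Sj -signr_odd oddB ?signr_odd -?oddD ?signr_odd //.
by rewrite Sj -ltnS.
Qed.

Lemma G_generator_diff r (a : 'I_r -> M) :
  G_generator a = diff [seq a t | t <- enum 'I_r] (@pt_class k A) 0.
Proof.
rewrite G_generator_sets (diff_sets _ _ _ (enum_uniq _)); apply: eq_big => S.
  by apply/esym/subsetP => t; rewrite mem_enum.
by rewrite add0r size_enum_ord.
Qed.

(** * The map from symmetric symbols to zero-cycles modulo the next step of [G] *)

Section Psi.
Variable r : nat.

(** These generate the step [r.+1] of [G], so [quotient G_gen] is the target of [Psi]. *)
Definition G_gen (c : CH0 A) : Prop := exists a : 'I_r.+1 -> M, c = G_generator a.

Lemma diff_G_gen (s : seq M) : size s = r.+1 -> G_gen (diff s (@pt_class k A) 0).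
Proof.
move=> sr; exists (fun t => nth 0 s t); rewrite G_generator_diff; congr diff.
have -> : [seq nth 0 s (t : 'I_r.+1) | t <- enum 'I_r.+1] = mkseq (nth 0 s) r.+1.
  by rewrite /mkseq -val_enum_ord -map_comp.
by rewrite -sr mkseq_nth.
Qed.

Definition gen_class (a : {ffun 'I_r -> M}) : quotient G_gen := cls G_gen (G_generator a).

(** Commutation brings the increment at [i] to the front. By [diffD] the defect of additivity is a
    difference with one more increment, hence zero in the quotient. *)
Lemma gen_class_multilinear (a b c : {ffun 'I_r -> M}) i :
  a i = b i + c i -> (forall j, j != i -> a j = b j /\ a j = c j) ->
  gen_class a = gen_class b + gen_class c.
Proof.
move=> ai aj; rewrite /gen_class -raddfD; apply: cls_sub_eq.
have split_i (d : {ffun 'I_r -> M}) :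
    G_generator d = diff (d i :: [seq d t | t <- rem i (enum 'I_r)]) (@pt_class k A) 0.
  rewrite G_generator_diff; apply: perm_diff.
  have : perm_eq (enum 'I_r) (i :: rem i (enum 'I_r)) by rewrite perm_to_rem ?mem_enum.
  exact: perm_map.
have rest (d : {ffun 'I_r -> M}) : (forall j, j != i -> a j = d j) ->
    [seq a t | t <- rem i (enum 'I_r)] = [seq d t | t <- rem i (enum 'I_r)].
  move=> ad; apply/eq_in_map => t; rewrite mem_rem_uniq ?enum_uniq // inE => /andP[ti _].
  exact: ad.
rewrite (split_i a) (split_i b) (split_i c).
rewrite -(rest b) => [|j /aj[]//]; rewrite -(rest c) => [|j /aj[]//].
rewrite ai diffD -[X in X - _]addrA addrK; apply: diff_G_gen.
rewrite /= size_map size_rem ?mem_enum // size_enum_ord.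
(* The increments number [r.-1 + 2], which is [r.+1] because the index [i] forces [r] to be
   positive. *)
by case: r i {ai aj split_i rest a b c} => [[]|].
Qed.

Definition Psi_tensor : tensor_power M r -> quotient G_gen :=
  descend (free_lift gen_class).
HB.instance Definition _ := GRing.isZmodMorphism.Build _ _ Psi_tensor
  (descend_is_zmod_morphism (free_lift_multilinear gen_class_multilinear)).

Lemma Psi_tensorE a : Psi_tensor (tens_pow a) = gen_class a.
Proof.
rewrite /Psi_tensor (descendE (free_lift_multilinear gen_class_multilinear)).
exact: free_liftU.
Qed.

(* As specialization is additive, the image of a Weil relation is an
   alternating sum of principal divisors on the curve, pushed forward by the
   sums of the [x j] over subsets. *)
Lemma Psi_tensor_weil z : weil_relation z -> Psi_tensor z = 0.
Proof.
move=> [K [i [f [x [s [Kff f0 fs ->]]]]]].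
transitivity (\sum_(v <- s) gen_class [ffun j => specialize v (x j)] *~ ord v f).
  rewrite (raddf_sumz Psi_tensor); apply: eq_bigr => v _.
  by congr (_ *~ _); exact: Psi_tensorE.
rewrite -(raddf_sumz (cls G_gen)).
under eq_bigr => v _ do rewrite G_generator_sets mulrz_suml.
rewrite exchange_big big1 ?raddf0 //= => S _.
under eq_bigr => v _ do rewrite mulrzAC.
rewrite -mulrz_suml (_ : \sum_(v <- s) _ = 0) ?mul0rz //.
transitivity (cls (@rationally_trivial k A)
    (\sum_(v <- s) << specialize v (\sum_(t in S) x t) >> *~ ord v f)).
  rewrite (raddf_sumz (cls (@rationally_trivial k A))).
  apply: eq_bigr => v _; congr (_ *~ _); congr pt_class.
  under eq_bigr => t _ do rewrite ffunE.
  elim/big_rec2: _ => [|t y1 y2 _ ->].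
    by apply: (addrI (specialize v 0)); rewrite -specializeD // !addr0.
  by rewrite specializeD.
by apply: cls_gen; exists K, i, f, (\sum_(t in S) x t), s.
Qed.

Definition Psi_somekawa : somekawa A r -> quotient G_gen := descend Psi_tensor.
HB.instance Definition _ := GRing.isZmodMorphism.Build _ _ Psi_somekawa
  (descend_is_zmod_morphism Psi_tensor_weil).

Lemma Psi_somekawaE a : Psi_somekawa (symbol a) = gen_class a.
Proof. by rewrite /Psi_somekawa (descendE Psi_tensor_weil); exact: Psi_tensorE. Qed.

Lemma Psi_somekawa_symmetry z : symmetry z -> Psi_somekawa z = 0.
Proof.
move=> [a [s ->]]; rewrite (raddfB Psi_somekawa).
apply/eqP; rewrite subr_eq0; apply/eqP.
transitivity (gen_class a); first exact: Psi_somekawaE.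
transitivity (gen_class [ffun j => a (s j)]); last exact/esym/Psi_somekawaE.
rewrite /gen_class !G_generator_diff; congr (cls _ _); apply: perm_diff.
rewrite perm_sym.
rewrite (eq_map (g := a \o s)) => [|t]; last by rewrite /= ffunE.
rewrite map_comp; apply: perm_map; apply: uniq_perm; rewrite ?enum_uniq //.
  by rewrite map_inj_uniq ?enum_uniq //; exact: perm_inj.
move=> t; rewrite mem_enum; apply/mapP; exists (s^-1%g t); rewrite ?mem_enum //.
by rewrite permKV.
Qed.

Definition Psi : sym_somekawa A r -> quotient G_gen := descend Psi_somekawa.
HB.instance Definition _ := GRing.isZmodMorphism.Build _ _ Psi
  (descend_is_zmod_morphism Psi_somekawa_symmetry).

Lemma Psi_sym_symbol a : Psi (sym_symbol a) = gen_class a.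
Proof. by rewrite /Psi (descendE Psi_somekawa_symmetry); exact: Psi_somekawaE. Qed.

End Psi.

(** * The maps [Phi] on generators and the two inclusions *)

Lemma sym_symbol_multilinear r (a b c : {ffun 'I_r -> M}) i :
  a i = b i + c i -> (forall j, j != i -> a j = b j /\ a j = c j) ->
  sym_symbol a = sym_symbol b + sym_symbol c.
Proof.
move=> ai aj; rewrite /sym_symbol /symbol.
by rewrite (tens_pow_multilinear ai aj) !raddfD.
Qed.

Lemma sym_symbol_perm r (a : {ffun 'I_r -> M}) (s : {perm 'I_r}) :
  sym_symbol [ffun j => a (s j)] = sym_symbol a.
Proof. by apply/esym/cls_sub_eq; exists a, s. Qed.

Lemma Phi0 j : Phi j (0 : CH0 A) = 0.
Proof. exact: (raddf0 (@Phi k A j)). Qed.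

Lemma Phi_ker_mulrn j (c : CH0 A) n : Phi j c = 0 -> Phi j (c *+ n) = 0.
Proof.
move=> c0; transitivity (Phi j c *+ n); first exact: (raddfMn (@Phi k A j)).
by rewrite c0 mul0rn.
Qed.

Lemma Phi_ker_sub j (c d : CH0 A) : Phi j c = 0 -> Phi j d = 0 -> Phi j (c - d) = 0.
Proof.
move=> c0 d0; transitivity (Phi j c - Phi j d); first exact: (raddfB (@Phi k A j)).
by rewrite c0 d0 subr0.
Qed.

Lemma Phi_G_generator j r (a : 'I_r -> M) :
  Phi j (G_generator a) =
  \sum_(S : {set 'I_r}) sym_symbol [ffun=> \sum_(t in S) a t] *~ (-1) ^+ (#|'I_r| + #|S|).
Proof.
rewrite G_generator_sets (raddf_sumz (Phi j)) card_ord.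
by apply: eq_bigr => S _; congr (_ *~ _); exact: Phi_pt_class.
Qed.

Lemma Phi_G_generator_lt j r (a : 'I_r -> M) : (j < r)%N -> Phi j (G_generator a) = 0.
Proof.
move=> jr; rewrite Phi_G_generator.
rewrite (@multilinear_polarization_lt _ _ _ _ _ _ (Ordinal jr)) ?card_ord //.
by move=> b c d i; exact: sym_symbol_multilinear.
Qed.

Lemma Phi_G_generator_eq r (a : {ffun 'I_r -> M}) : (0 < r)%N ->
  Phi r (G_generator a) = sym_symbol a *+ r`!.
Proof.
move=> r0; rewrite Phi_G_generator.
rewrite (@multilinear_polarization_eq _ _ _ _ (Ordinal r0)) ?card_ord //.
  by move=> b c d i; exact: sym_symbol_multilinear.
exact: sym_symbol_perm.
Qed.

(** Both sides are additive in [c]. On a generator, polarization yields [r!] times a symbol, which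
    [Psi] sends back to the class of that generator. *)
Lemma Psi_Phi r c : (0 < r)%N -> c \in G_filtration A r ->
  Psi (Phi r c) = cls (@G_gen r) (c *+ r`!).
Proof.
case: r => // r _; move: c; apply: (@subgroup_gen_ind _ _
  (fun c => Psi (Phi r.+1 c) = cls (@G_gen r.+1) (c *+ r.+1`!))) => [|x y xE yE|_ [a ->]].
- by rewrite mul0rn !raddf0.
- by rewrite !raddfB /= xE yE mulrnBl [RHS]raddfB.
pose b := [ffun t => a t].
have -> : G_generator a = G_generator b.
  by rewrite !G_generator_diff; congr diff; apply: eq_map => t; rewrite ffunE.
by rewrite Phi_G_generator_eq // !raddfMn; congr (_ *+ _); exact: Psi_sym_symbol.
Qed.

(** On generators, [Phi j] with [0 < j < r] vanishes by polarization with too few slots; for [j = 0]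
    the degree is the alternating sum over all subsets, which is zero. *)
Lemma G_filtration_sub r : (0 < r)%N -> {subset G_filtration A r <= F_filtration A r}.
Proof.
case: r => // r _.
apply: (@subgroup_gen_ind _ _ (fun c => c \in F_filtration A r.+1))
    => [|x y /asboolP xF /asboolP yF|_ [a ->]];
  apply/asboolP => -[|j] jr /=.
- by exists 0; rewrite ?deg0 ?raddf0.
- exact: Phi0.
- have [z z0 ->] := xF 0%N jr; have [w w0 ->] := yF 0%N jr.
  by exists (z - w); rewrite ?degB ?z0 ?w0 ?subrr ?raddfB.
- exact: (Phi_ker_sub (xF j.+1 jr) (yF j.+1 jr)).
- exists (\sum_(S : {set 'I_r.+1}) << \sum_(t in S) a t >> *~ (-1) ^+ (r.+1 + #|S|)).
    transitivity (\sum_(S : {set 'I_r.+1}) (-1) ^+ (r.+1 + #|S|) : int); last first.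
      by have := @sum_sign_sets 'I_r.+1; rewrite card_ord; exact.
    exact: deg_sum.
  by rewrite G_generator_sets (raddf_sumz (cls (@rationally_trivial k A))).
exact: Phi_G_generator_lt.
Qed.

(** Subtracting [deg z] times the class of the origin, which is zero here, writes the cycle as a
    combination of first differences [[t] - [0]]. *)
Lemma F_filtration1 : {subset F_filtration A 1 <= G_filtration A 1}.
Proof.
move=> c /asboolP/(_ 0%N isT)[z z0 ->].
have zE : cls (@rationally_trivial k A) z =
    \sum_(t <- dom z) (pt_class t - pt_class 0) *~ coeff t z.
  have -> : \sum_(t <- dom z) (pt_class t - pt_class 0) *~ coeff t z =
      \sum_(t <- dom z) pt_class t *~ coeff t z - pt_class 0 *~ deg z.
    rewrite [in deg z](free_decomp z) deg_sum mulrz_sumr -sumrB.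
    by apply: eq_bigr => t _; rewrite mulrzBl.
  rewrite z0 mulr0z subr0 [in LHS](free_decomp z).
  exact: (raddf_sumz (cls (@rationally_trivial k A))).
rewrite zE rpred_sum // => t _; rewrite rpredMz //.
apply: mem_subgroup_gen; have := @diff_G_gen 0 [:: t] erefl.
by rewrite /= add0r.
Qed.

Lemma F_filtration_sub r c : c \in F_filtration A r.+1 ->
  c *+ (\prod_(j < r.+1) j`!) \in G_filtration A r.+1.
Proof.
elim: r => [|r IH] cF; first by rewrite big_ord1 F_filtration1.
move/asboolP in cF.
have /IH cG : c \in F_filtration A r.+1.
  by apply/asboolP => j jr; apply: cF; exact: leq_trans jr _.
rewrite big_ord_recr mulrnA.
(* The multiple of [c] found so far lies in the step [r.+1] of [G], where [Psi] after [Phi r.+1] is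
   multiplication by [r.+1!]; but [Phi r.+1] kills [c]. *)
have /eqP : cls (@G_gen r.+1) (c *+ (\prod_(j < r.+1) j`!) *+ r.+1`!) = 0.
  rewrite -(Psi_Phi (ltn0Sn r) cG).
  by rewrite (Phi_ker_mulrn _ (cF r.+1 (leqnn _))) raddf0.
by rewrite -(raddf0 (cls (@G_gen r.+1))) cls_eq subr0.
Qed.

End Filtrations.

(** * Passage to coefficients in which the factorials are invertible *)

Section TensorSub.
Variables M N : zmodType.

Lemma tensDl (x x' : M) (y : N) : tens (x + x') y = tens x y + tens x' y.
Proof.
rewrite /tens -raddfD; apply: cls_sub_eq; left.
by exists x, x', y; rewrite opprD addrA.
Qed.

Lemma tensDr (x : M) (y y' : N) : tens x (y + y') = tens x y + tens x y'.
Proof.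
rewrite /tens -raddfD; apply: cls_sub_eq; right.
by exists x, y, y'; rewrite opprD addrA.
Qed.

Lemma tens0l (y : N) : tens (0 : M) y = 0.
Proof. by apply: (addrI (tens 0 y)); rewrite -tensDl !addr0. Qed.

Lemma tens0r (x : M) : tens x (0 : N) = 0.
Proof. by apply: (addrI (tens x 0)); rewrite -tensDr !addr0. Qed.

Lemma tens_mulrn (x : M) (y : N) n : tens (x *+ n) y = tens x (y *+ n).
Proof.
elim: n => [|n IH]; first by rewrite tens0l tens0r.
by rewrite !mulrS tensDl tensDr IH.
Qed.

Lemma tensor_sub_gen (H H' : {pred M}) :
  (forall x (y : N), x \in H -> tens x y \in tensor_sub N H') ->
  {subset tensor_sub N H <= tensor_sub N H'}.
Proof.
move=> HH'; apply: (@subgroup_gen_ind _ _ (fun z => z \in tensor_sub N H'))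
  => [|x y xH yH|_ [x xH [y ->]]].
- exact: rpred0.
- exact: rpredB.
exact: HH'.
Qed.

End TensorSub.

(** If [n ^ e = q * m], then [1 / m = q / n ^ e], so dividing by [m] only raises the power of [n] in
    the denominator by [e]. *)
Lemma Zinv_divisible n m e (y : Zinv n) : (m %| n ^ e)%N -> (0 < n)%N ->
  exists y' : Zinv n, y = y' *+ m.
Proof.
move=> /dvdnP[q nE] n0.
have mq0 : (m%:R : rat) != 0.
  by rewrite pnatr_eq0 -lt0n; move: (expn_gt0 n e); rewrite nE n0 muln_gt0 => /andP[].
have yP : val y / m%:R \in invert_nat n.
  have /asboolP[d yd] := valP y; apply/asboolP; exists (d + e)%N.
  rewrite exprD -natrX -natrX nE natrM mulrACA.
  rewrite (mulrC q%:R) (mulrA m%:R^-1) mulVf // mul1r natrX.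
  by rewrite rpredM // rpred_nat.
exists (MkZinv yP); apply: val_inj; rewrite raddfMn /=.
by rewrite -[RHS]mulr_natr divfK.
Qed.

(** Each of the [r.+1] factors divides [r!]; hence the multiplier in [F_filtration_sub] becomes
    invertible once [r!] is. *)
Lemma prod_fact_dvd r : (\prod_(j < r.+1) j`! %| r`! ^ r.+1)%N.
Proof.
rewrite -[in X in (_ %| X)%N](card_ord r.+1) -prod_nat_const.
elim/big_ind2: _ => // [a b c d ab cd|j _]; first exact: dvdn_mul.
by rewrite (@fact_split r j) ?dvdn_mulr // -ltnS.
Qed.

Theorem proposition4p1 (k : closedFieldType) (A : abelian_variety k) (r : nat)
    (hr : (1 <= r)%N) :
  tensor_sub (Zinv (r.-1)`!) (F_filtration A r)
    =i tensor_sub (Zinv (r.-1)`!) (G_filtration A r).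
Proof.
case: r hr => // r _ z; apply/idP/idP; move: z; apply: tensor_sub_gen => c y cH.
  (* The multiplier is split off the coefficient [y] and moved across the tensor sign onto [c],
     which it carries into [G]. *)
  have [y' ->] := Zinv_divisible y (prod_fact_dvd r) (fact_gt0 r).
  rewrite -tens_mulrn; apply: mem_subgroup_gen.
  by exists (c *+ \prod_(j < r.+1) j`!); [exact: F_filtration_sub | exists y'].
by apply: mem_subgroup_gen; exists c; [exact: G_filtration_sub | exists y].
Qed.
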